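(* Let $d \geqslant 1$ and $k \geqslant 2$ be integers, and let $X \subset [0,1]^d$ be a nonempty $k$-self-similar set. Let $X_0,\ldots,X_{n-1}$ be the distinct nonempty sets in the $k$-kernel of $X$, and let $A = \{A_{ij}\}_{i,j=0}^{n-1}$ be the matrix in which $A_{ij}$ is the number of $\frac{1}{k}$-scaled copies of $X_i$ contained in $X_j$. Then the entropy $h(X)$ of $X$ is equal to $$h(X) = \lim_{p \to \infty}\frac{1}{p}\log_{k}\big(\mathcal{P}(\mathcal{L}_{X},p)\big) = \log_{k}(\rho(A)),$$ where $\rho(A)$ is the spectral radius of $A$.
   Context: **$k$-self-similar sets.** For a compact set $Y \subset [0,1]^{d}$, an integer $k \geqslant 2$, an integer $a \geqslant 0$ and $\mathbf{b} = (b_1,\ldots,b_d) \in \mathbb{Z}^d$ with $0 \leqslant b_i < k^a$ for each $i$, set $$\mathcal{K}_{a,\mathbf{b}}^{k}(Y) := \Big\{(k^{a}x_{1}-b_{1},\ldots,k^{a}x_{d}-b_{d}) \;:\; (x_{1},\ldots,x_{d}) \in Y \cap \prod_{i=1}^{d}\Big[\frac{b_{i}}{k^{a}},\frac{b_{i}+1}{k^{a}}\Big]\Big\} \subset [0,1]^d.$$ The $k$-kernel of a compact set $X \subset [0,1]^d$ is the collection $\mathcal{K}_X^k = \{\mathcal{K}_{a,\mathbf{b}}^{k}(X) : a \geqslant 0,\ 0 \leqslant b_i < k^a\}$. The compact set $X$ is called $k$-self-similar if $\mathcal{K}_X^k$ is finite. **The matrix $A$.** If $X_0,\ldots,X_{n-1}$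 are the distinct nonempty elements of $\mathcal{K}_X^k$, each $X_j$ is the union of its intersections with the closed grid hyper-cubes $\prod_{l=1}^d [\frac{b_l}{k},\frac{b_l+1}{k}]$, and each nonempty such intersection is a $\frac1k$-scaled copy of some $X_i$. ''The number of $\frac1k$-scaled copies of $X_i$ contained in $X_j$'' means the number of such grid cubes for which the rescaled intersection is $X_i$: $$A_{ij} = \#\{\mathbf{b} \in \{0,\ldots,k-1\}^d : \mathcal{K}_{1,\mathbf{b}}^k(X_j) = X_i\}.$$ **The language $\mathcal{L}_X$.** The alphabet is $\varSigma_k^d = \{0,\ldots,k-1\}^d$. A base-$k$ representation of $t \in [0,1]$ is a sequence $(b^{(1)}, b^{(2)}, \ldots)$ with $b^{(j)} \in \{0,\ldots,k-1\}$ and $t = \sum_{j \geqslant 1} b^{(j)} k^{-j}$ (so representations have the form $0.b^{(1)}b^{(2)}\cdots$; a number having two such representations is considered with both of them; $0$ and $1$ have only one each). For $x = (x_1,\ldots,x_d) \in X$ and any choice, for each $i$, of a base-$k$ representation $(b_i^{(1)}, b_i^{(2)},\ldots)$ of $x_i$, form the infinite word $\mathbf{w}$ over $\varSigma_k^d$ whose $j$-th letter is $(b_1^{(j)},\ldots,b_d^{(j)})$. The language $\mathcal{L}_X$ is the set of all finite words consisting of consecutive letters (at positions $m+1,\ldots,m+p$, for $m,p \geqslant 0$) of some such infinite word $\mathbf{w}$, over all $x \in X$ and all choices of representations of the coordinates. **Entropy.** For $p \geqslant 1$ let $\mathcal{P}(\mathcal{L}_X,p)$ be the number of words of length $p$ in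 $\mathcal{L}_X$. Since $\mathcal{L}_X$ is closed under taking subwords (blocks of consecutive letters), $\mathcal{P}(\mathcal{L}_X,p+q) \leqslant \mathcal{P}(\mathcal{L}_X,p)\mathcal{P}(\mathcal{L}_X,q)$, and the entropy of $X$ is defined as $h(X) = \lim_{p\to\infty} \frac{1}{p}\log_k(\mathcal{P}(\mathcal{L}_X,p))$. *)

(* Defs.v *)
(* MathComp / MathComp-Analysis, over an arbitrary [R : realType]. *)
From HB Require Import structures.
From mathcomp Require Import all_boot all_order all_algebra.
From mathcomp Require Import complex.
From mathcomp Require Import all_classical all_reals all_analysis.

Set Implicit Arguments.
Unset Strict Implicit.
Unset Printing Implicit Defensive.

Import Order.TTheory GRing.Theory Num.Theory.
Import numFieldNormedType.Exports.

Local Open Scope classical_set_scope.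
Local Open Scope ring_scope.

Definition unit_cube (R : realType) (d : nat) : set 'rV[R]_d :=
  [set x | forall l, 0 <= x ord0 l <= 1].

Definition grid_cube (R : realType) (d k a : nat) (b : 'I_d -> nat) :
    set 'rV[R]_d :=
  [set x | forall l, (b l)%:R / k%:R ^+ a <= x ord0 l
                     <= ((b l)%:R + 1) / k%:R ^+ a].

Definition rescaled_piece (R : realType) (d k a : nat) (b : 'I_d -> nat)
    (Y : set 'rV[R]_d) : set 'rV[R]_d :=
  [set \row_l (k%:R ^+ a * x ord0 l - (b l)%:R) | x in Y `&` grid_cube k a b].

Definition kernel_sets (R : realType) (d k : nat) (X : set 'rV[R]_d) :
    set (set 'rV[R]_d) :=
  [set Z | exists (a : nat) (b : 'I_d -> nat),
             (forall l, (b l < k ^ a)%N) /\ Z = rescaled_piece k a b X].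

Definition self_similar (R : realType) (d k : nat) (X : set 'rV[R]_d) : Prop :=
  [/\ compact X, X `<=` @unit_cube R d & finite_set (kernel_sets k X)].

Definition letter (d k : nat) := {ffun 'I_d -> 'I_k}.

Definition copies_matrix (R : realType) (d k n : nat)
    (Xs : 'I_n -> set 'rV[R]_d) : 'M[R]_n :=
  \matrix_(i, j)
    #|[pred b : letter d k |
        `[< rescaled_piece k 1 (fun l => b l) (Xs j) = Xs i >]]|%:R.

(* The digit of weight [k ^- j.+1] is [c j]. *)
Definition is_representation (R : realType) (k : nat) (c : nat -> 'I_k)
    (t : R) : Prop :=
  [series (c j)%:R / k%:R ^+ j.+1 : R]_j @ \oo --> t.

Definition language (R : realType) (d k : nat) (X : set 'rV[R]_d) :
    set (seq (letter d k)) :=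
  [set u | exists (x : 'rV[R]_d) (c : 'I_d -> nat -> 'I_k) (m p : nat),
     [/\ X x,
         forall l, is_representation (c l) (x ord0 l)
       & u = mkseq (fun j => [ffun l => c l (m + j)%N]) p]].

Definition complexity (R : realType) (d k : nat) (X : set 'rV[R]_d)
    (p : nat) : nat :=
  #|[pred u : p.-tuple (letter d k) | `[< language X (tval u) >]]|.

Definition log (R : realType) (k : nat) (x : R) : R := ln x / ln k%:R.

(* The value at [p = 0] is irrelevant to the limit. *)
Definition entropy_seq (R : realType) (d k : nat) (X : set 'rV[R]_d)
    (p : nat) : R :=
  p%:R^-1 * log k (complexity k X p)%:R.

Definition entropy (R : realType) (d k : nat) (X : set 'rV[R]_d) : R :=
  limn (entropy_seq k X).

(* The modulus of a complex number is itself typed in [R[i]], hence the real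
   part; the set is finite, and nonempty as soon as [0 < n], so that its
   supremum is the maximum of the moduli of the eigenvalues. *)
Definition spectral_radius (R : realType) (n : nat) (A : 'M[R]_n) : R :=
  sup [set complex.Re `|z| | z in
        [set z : R[i] | eigenvalue (map_mx (real_complex R) A) z]].

(* Main.v *)
(* The map [x |-> k x - b] deletes the leading letter [b] of an expansion of [x], so
   [word_piece u Z], the set obtained from [Z] by zooming in successively
   along the letters of [u], is nonempty exactly when [u] is a prefix of an expansion
   of a point of [Z].  Hence [u] is in the language of [X] iff [word_piece u (Xs i)]
   is nonempty for some [i].  Words of length [p] with [word_piece u (Xs j)] nonempty
   are the paths of length [p] from [j] in the graph with adjacency matrix [A], so
   there are [\sum_i (A ^+ p) i j] of them and the complexity equals
   [\sum_j \sum_i (A ^+ p) i j] up to a factor [n].  Gelfand's formula concludes: an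
   eigenvector bounds this sum below by [|z| ^ p], and Cayley-Hamilton bounds it above
   by [K * (rho + e) ^ p]. *)
Require Import Defs.
From HB Require Import structures.
From mathcomp Require Import all_boot all_order all_algebra.
From mathcomp Require Import complex.
From mathcomp Require Import all_classical all_reals all_analysis.
From mathcomp Require Import ring lra.

Set Implicit Arguments.
Unset Strict Implicit.
Unset Printing Implicit Defensive.

Import Order.TTheory GRing.Theory Num.Theory.
Import numFieldNormedType.Exports.

Local Open Scope classical_set_scope.
Local Open Scope ring_scope.

(** * Growth of the powers of a complex matrix *)

(** The gap [e] between the ratio [r] and the rate [r + e] absorbs the forcing term, because
    [e * K'] is at least [K]. No polynomial factor appears, even for repeated roots. *)
Lemma recurrence_bound (C : numFieldType) (a b : nat -> C) (z r e K : C) :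
  `|z| <= r -> 0 < e -> 0 <= K -> (forall p, a p.+1 = z * a p + b p) ->
  (forall p, `|b p| <= K * (r + e) ^+ p) ->
  exists2 K', 0 <= K' & forall p, `|a p| <= K' * (r + e) ^+ p.
Proof.
move=> zr e0 K0 ab bK; have r0 : 0 <= r by apply: le_trans zr.
have re0 : 0 <= r + e by rewrite addr_ge0 // ltW.
exists (`|a 0| + K / e); first by rewrite addr_ge0 // divr_ge0 // ltW.
elim=> [|p IH]; first by rewrite expr0 mulr1 lerDl divr_ge0 // ltW.
rewrite ab (le_trans (ler_normD _ _)) // normrM.
have {}IH : `|z| * `|a p| <= r * ((`|a 0| + K / e) * (r + e) ^+ p).
  by rewrite ler_pM.
rewrite (le_trans (lerD IH (bK p))) // -subr_ge0.
have -> : (`|a 0| + K / e) * (r + e) ^+ p.+1 -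
    (r * ((`|a 0| + K / e) * (r + e) ^+ p) + K * (r + e) ^+ p) =
    e * `|a 0| * (r + e) ^+ p by rewrite exprS; field; rewrite gt_eqF.
by rewrite !mulr_ge0 ?exprn_ge0 // ltW.
Qed.

(* Cayley-Hamilton: the factors of the characteristic polynomial are removed one at a
   time, each removal being a scalar recurrence of order one. *)
Lemma expmx_bound (C : numClosedFieldType) (n : nat) (A : 'M[C]_n.+1) (r e : C) :
  (forall z, eigenvalue A z -> `|z| <= r) -> 0 < e ->
  forall i j, exists2 K, 0 <= K & forall p, `|(A ^+ p) i j| <= K * (r + e) ^+ p.
Proof.
move=> Ar e0 i j.
have peel (s : seq C) (q : {poly C}) : (forall z, z \in s -> `|z| <= r) ->
    (exists2 K, 0 <= K & forall p,
       `|horner_mx A ('X^p * (q * \prod_(z <- s) ('X - z%:P))) i j|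
         <= K * (r + e) ^+ p) ->
    exists2 K, 0 <= K & forall p, `|horner_mx A ('X^p * q) i j| <= K * (r + e) ^+ p.
  elim: s q => [|z s IH] q sr.
    by case=> K K0 HK; exists K => // p; have := HK p; rewrite big_nil mulr1.
  rewrite big_cons mulrA => /IH [y ys|K K0 HK]; first by rewrite sr ?inE ?ys ?orbT.
  apply: (@recurrence_bound _ _ _ z r e K) (HK) => //; first by rewrite sr ?mem_head.
  (* Writing one factor ['X] as [z + ('X - z)] gives the recurrence; its forcing term carries one
     more root factor and is already bounded. *)
  move=> p; have -> : 'X^(p.+1) * q = z *: ('X^p * q) + 'X^p * (q * ('X - z%:P)).
    by rewrite exprSr -mul_polyC; ring.
  by rewrite linearD linearZ !mxE.
have [s Ds] := closed_field_poly_normal (char_poly A).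
rewrite (monicP (char_poly_monic A)) scale1r in Ds.
have [||K K0 HK] := peel s 1.
- by move=> z zs; rewrite Ar // eigenvalue_root_char Ds root_prod_XsubC.
- exists 0 => // p; rewrite mul1r -Ds rmorphM /= Cayley_Hamilton mulr0 mxE normr0 mul0r.
  exact: lexx.
exists K => // p; have := HK p.
by rewrite mulr1 rmorphXn /= horner_mx_X.
Qed.

(** A row eigenvector [v] satisfies [v *m A ^+ p = z ^+ p *: v]; reading this at a nonzero
    coordinate [j] of [v] gives the bound. *)
Lemma eigenvalue_exp_le (C : numClosedFieldType) (n : nat) (A : 'M[C]_n.+1) (z : C) :
  eigenvalue A z ->
  exists K, forall p, `|z| ^+ p <= K * \sum_j \sum_i `|(A ^+ p) i j|.
Proof.
move=> /eigenvalueP[v vA v0].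
have vAp p : v *m A ^+ p = z ^+ p *: v.
  elim: p => [|p IH]; first by rewrite !expr0 mulmx1 scale1r.
  by rewrite exprSr exprS [_ * A]/GRing.mul /= mulmxA IH -scalemxAl vA scalerA mulrC.
have [j vj] : exists j, v 0 j != 0.
  by move: v0 => /rV0Pn.
exists ((\sum_i `|v 0 i|) / `|v 0 j|) => p.
rewrite mulrAC ler_pdivlMr ?normr_gt0 // -normrX -normrM.
have -> : z ^+ p * v 0 j = (z ^+ p *: v) 0 j by rewrite mxE.
rewrite -vAp mxE (le_trans (ler_norm_sum _ _ _)) // mulr_suml.
apply: ler_sum => i _; rewrite normrM ler_wpM2l //.
rewrite (bigD1 j) //= (bigD1 i) //= -addrA lerDl.
by rewrite addr_ge0 ?sumr_ge0 // => k _; rewrite sumr_ge0.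
Qed.

(** * Spectral radius and entry sums of powers of a nonnegative matrix *)

Section SpectralRadius.
Variables (R : realType) (n : nat) (A : 'M[R]_n.+1).
Hypothesis A0 : forall i j, 0 <= A i j.
Let AC := map_mx (real_complex R) A.
Let S p := \sum_j \sum_i (A ^+ p) i j.

Let normCE (z : R[i]) : `|z| = (complex.Re `|z|)%:C%C.
Proof. by rewrite normc_def. Qed.

Lemma exp_nonneg_mx p i j : 0 <= (A ^+ p) i j.
Proof.
elim: p i j => [|p IH] i j; first by rewrite mxE; case: eqP.
by rewrite exprSr mxE sumr_ge0 // => k _; rewrite mulr_ge0.
Qed.

Let normACX p i j : `|(AC ^+ p) i j| = ((A ^+ p) i j)%:C%C.
Proof.
rewrite -(rmorphXn (map_mx (real_complex R))) mxE ger0_norm //.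
by rewrite lecR exp_nonneg_mx.
Qed.

(** Eigenvalues are roots of the characteristic polynomial, so the sum of the moduli of all its
    roots is an upper bound. *)
Lemma has_ubound_eigenvalue :
  has_ubound [set complex.Re `|z| | z in [set z : R[i] | eigenvalue AC z]].
Proof.
have [s Ds] := closed_field_poly_normal (char_poly AC).
rewrite (monicP (char_poly_monic AC)) scale1r in Ds.
exists (\sum_(z <- s) complex.Re `|z|); move=> _ [z /= Az <-].
have Re0 (y : R[i]) : 0 <= complex.Re `|y| by rewrite -lecR -normCE normr_ge0.
have zs : z \in s by move: Az; rewrite eigenvalue_root_char Ds root_prod_XsubC.
by rewrite (big_rem z) //= lerDl; apply: sumr_ge0 => y _; exact: Re0.
Qed.

Lemma eigenvalue_le_spectral_radius z :
  eigenvalue AC z -> `|z| <= (spectral_radius A)%:C%C.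
Proof.
move=> Az; rewrite normCE lecR; apply: ub_le_sup; last by exists z.
exact: has_ubound_eigenvalue.
Qed.

Lemma sum_expmx_le r : spectral_radius A < r ->
  exists K, forall p, S p <= K * r ^+ p.
Proof.
move=> rho_r; set e := r - spectral_radius A.
have e0 : 0 < e%:C%C by rewrite ltcR subr_gt0.
have [K HK] : exists K : 'I_n.+1 -> 'I_n.+1 -> R[i],
    forall i j, 0 <= K i j /\ forall p, `|(AC ^+ p) i j| <= K i j * r%:C%C ^+ p.
  (* The bounds hold entry by entry; choice turns them into a matrix of constants that can be
     summed. *)
  have H i j : exists K, 0 <= K /\ forall p, `|(AC ^+ p) i j| <= K * r%:C%C ^+ p.
    have [K K0 KA] := expmx_bound eigenvalue_le_spectral_radius e0 i j.
    exists K; split => // p; have := KA p.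
    by rewrite -rmorphD /= /e addrC subrK.
  exists (fun i j => sval (cid (H i j))) => i j.
  exact: svalP (cid (H i j)).
exists (\sum_j \sum_i complex.Re `|K i j|) => p.
rewrite mulr_suml; apply: ler_sum => j _; rewrite mulr_suml; apply: ler_sum => i _.
have [K0 /(_ p)] := HK i j.
by rewrite normACX -{1}(ger0_norm K0) normCE -rmorphXn -rmorphM lecR.
Qed.

Lemma sum_expmx_ge r : 0 <= r -> r < spectral_radius A ->
  exists2 K, 0 < K & forall p, r ^+ p <= K * S p.
Proof.
move=> r0 r_rho.
set E := [set complex.Re `|z| | z in [set z : R[i] | eigenvalue AC z]].
have E_sup : has_sup E.
  (* Without a supremum, [sup] takes the default value [0], which contradicts
     [0 <= r < spectral_radius A]. *)
  apply: contrapT => /sup_out supE; move: (le_lt_trans r0 r_rho).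
  by rewrite /spectral_radius -/AC -/E supE ltxx.
have e0 : 0 < spectral_radius A - r by rewrite subr_gt0.
have [_ [z /= Az <-]] := sup_adherent e0 E_sup.
rewrite opprB addrCA subrr addr0 => r_z.
have [K HK] := eigenvalue_exp_le Az.
have S0 p : 0 <= S p.
  by apply: sumr_ge0 => j _; apply: sumr_ge0 => i _; exact: exp_nonneg_mx.
(* [K] is complex with no sign information: its modulus replaces it, and the added [1] makes the
   constant strictly positive. *)
exists (1 + complex.Re `|K|) => [|p].
  by rewrite ltr_wpDr // -lecR -normCE normr_ge0.
have {HK} := HK p.
have -> : \sum_j \sum_i `|(AC ^+ p) i j| = (S p)%:C%C.
  rewrite /S rmorph_sum /=; apply: eq_bigr => j _.
  by rewrite rmorph_sum /=; apply: eq_bigr => i _.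
move=> HK.
have {HK} : `|z| ^+ p <= `|K| * (S p)%:C%C.
  rewrite -[`|z| ^+ p]ger0_norm ?exprn_ge0 //.
  have Sc0 : 0 <= (S p)%:C%C by rewrite lecR.
  rewrite -[X in _ <= _ * X](ger0_norm Sc0) -normrM.
  rewrite ger0_norm ?exprn_ge0 // (le_trans HK) // real_ler_norm //.
  by apply: ger0_real; apply: le_trans HK; rewrite exprn_ge0.
rewrite [`|z|]normCE [`|K|]normCE -rmorphXn -rmorphM lecR => HK.
rewrite (le_trans (lerXn2r p _ _ (ltW r_z))) ?nnegrE //.
  exact: le_trans (ltW r_z).
by rewrite mulrDl mul1r (le_trans HK) // lerDr.
Qed.

(** Otherwise [2^-1] exceeds the spectral radius, and [S p <= K * 2^-1 ^+ p] would tend to [0]. *)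
Lemma spectral_radius_gt0 : (forall p, 1 <= S p) -> 0 < spectral_radius A.
Proof.
move=> S1; rewrite ltNge; apply/negP => rho0.
have [|K HK] := @sum_expmx_le 2^-1; first by rewrite (le_lt_trans rho0) // invr_gt0.
have : geometric K (2^-1 : R) @ \oo --> 0.
  by apply: cvg_geometric; rewrite ger0_norm // invf_lt1 // ltr1n.
move=> /cvgrPdist_lt /(_ 1 ltr01) [N _ /(_ N (leqnn _)) /=].
rewrite sub0r normrN ltNge => /negP; apply.
by rewrite (le_trans (S1 N)) // (le_trans (HK N)) // ler_norm.
Qed.

End SpectralRadius.

(** * From geometric bounds to a logarithmic growth rate *)

(** The rates [rho * expR (eps / 2)] and [rho * expR (- (eps / 2))] cost [eps / 2] after taking
    logarithms; the other half of [eps] pays for the constants, whose logarithms are divided by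
    [p]. *)
Lemma cvg_ln_root (R : realType) (a : nat -> R) (rho : R) : 0 < rho ->
  (forall p, 0 < a p) ->
  (forall r, rho < r -> exists K, forall p, a p <= K * r ^+ p) ->
  (forall r, 0 <= r -> r < rho -> exists2 K, 0 < K & forall p, r ^+ p <= K * a p) ->
  (fun p => p%:R^-1 * ln (a p)) @ \oo --> ln rho.
Proof.
move=> rho0 a0 ale age; apply/cvgrPdist_le => eps eps0.
have eps20 : 0 < eps / 2 by rewrite divr_gt0.
set r1 := rho * expR (eps / 2); set r2 := rho * expR (- (eps / 2)).
have r10 : 0 < r1 by rewrite mulr_gt0 ?expR_gt0.
have r20 : 0 < r2 by rewrite mulr_gt0 ?expR_gt0.
have [|K1 HK1] := ale r1; first by rewrite ltr_pMr // expR_gt1.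
have [||K2 K20 HK2] := age r2; [exact: ltW|by rewrite gtr_pMr // expR_lt1 oppr_lt0|].
(* Positivity of [K1] comes from the bound at [p = 0]. *)
have K10 : 0 < K1.
  by have := HK1 0; rewrite expr0 mulr1; apply: lt_le_trans.
have lnr1 : ln r1 = ln rho + eps / 2 by rewrite lnM ?posrE ?expR_gt0 // expRK.
have lnr2 : ln r2 = ln rho - eps / 2 by rewrite lnM ?posrE ?expR_gt0 // expRK.
have hN : \forall p \near \oo, (`|ln K1| + `|ln K2|) / (eps / 2) <= p%:R :> R.
  exact: nbhs_infty_ger.
near=> p.
have p0 : 0 < p%:R :> R by rewrite ltr0n; near: p; exact: nbhs_infty_gt.
have hp : `|ln K1| + `|ln K2| <= eps / 2 * p%:R.
  by rewrite mulrC -ler_pdivrMr //; near: p.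
have up : ln (a p) <= ln K1 + p%:R * (ln rho + eps / 2).
  rewrite -lnr1 mulr_natl -lnXn // -lnM ?posrE ?exprn_gt0 //.
  by rewrite ler_ln ?posrE ?mulr_gt0 ?exprn_gt0.
have lo : p%:R * (ln rho - eps / 2) <= ln K2 + ln (a p).
  rewrite -lnr2 mulr_natl -lnXn // -lnM ?posrE ?exprn_gt0 //.
  by rewrite ler_ln ?posrE ?mulr_gt0 ?exprn_gt0.
have l1 := ler_norm (ln K1); have l2 := ler_norm (ln K2).
have m1 := normr_ge0 (ln K1); have m2 := normr_ge0 (ln K2).
rewrite ler_distlC; apply/andP; split.
  rewrite mulrC ler_pdivlMr //; nra.
rewrite mulrC ler_pdivrMr //; nra.
Unshelve. all: end_near. Qed.

(** * Base-[k] representations of real numbers *)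

Section Representations.
Variables (R : realType) (k : nat).
Hypothesis k_gt1 : (1 < k)%N.

Let k_gt0 : (0 < k)%N. Proof. exact: ltnW. Qed.

Let k0 : k%:R != 0 :> R. Proof. by rewrite pnatr_eq0 -lt0n. Qed.
Let kp : 0 < k%:R :> R. Proof. by rewrite ltr0n. Qed.

Let digit_series (c : nat -> 'I_k) : R^nat := [series (c j)%:R / k%:R ^+ j.+1 : R]_j.

Let digit_seriesS c n :
  digit_series c n.+1 = ((c 0%N)%:R + digit_series (fun j => c j.+1) n) / k%:R.
Proof.
rewrite /digit_series !seriesEnat /= big_nat_recl // mulrDl expr1 mulr_suml.
congr (_ + _); apply: eq_bigr => i _.
by rewrite (exprS _ i.+1) invfM mulrA mulrAC.
Qed.

(** Both directions pass to the limit in [digit_seriesS]: one deletes the leading digit, the other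
    prepends one. *)
Lemma representation_shift (c : nat -> 'I_k) (t : R) :
  is_representation c t <->
  is_representation (fun j => c j.+1) (k%:R * t - (c 0%N)%:R).
Proof.
rewrite /is_representation -!/(digit_series _); split => H.
  have -> : digit_series (fun j => c j.+1) =
      (fun n => k%:R * digit_series c n.+1 - (c 0%N)%:R).
    by apply/funext => n; rewrite digit_seriesS; field.
  apply: cvgB; last exact: cvg_cst.
  apply: cvgM; first exact: cvg_cst.
  by rewrite (cvg_shiftS (digit_series c)).
rewrite -(cvg_shiftS (digit_series c)).
have -> : [sequence digit_series c n.+1]_n =
    (fun n => ((c 0%N)%:R + digit_series (fun j => c j.+1) n) / k%:R).
  by apply/funext => n; rewrite -digit_seriesS.
have -> : t = ((c 0%N)%:R + (k%:R * t - (c 0%N)%:R)) / k%:R by field.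
apply: cvgM; last exact: cvg_cst.
by apply: cvgD => //; exact: cvg_cst.
Qed.

Lemma representation_itv (c : nat -> 'I_k) (t : R) :
  is_representation c t -> 0 <= t <= 1.
Proof.
(* The sequence is quantified inside the induction because the step passes to its shift; the upper
   bound uses [c 0 + 1 <= k]. *)
have bd n : forall c, 0 <= digit_series c n <= 1.
  elim: n => [|n IH] {}c.
    by rewrite /digit_series seriesEnat /= big_geq // lexx ler01.
  rewrite digit_seriesS; have /andP[h0 h1] := IH (fun j => c j.+1).
  rewrite divr_ge0 ?addr_ge0 // ler_pdivrMr // mul1r (le_trans (lerD (lexx _) h1)) //.
  by rewrite natr1 ler_nat.
move=> H; have cH : cvgn (digit_series c) by apply/cvg_ex; exists t.
have <- : limn (digit_series c) = t by exact: cvg_lim H.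
by rewrite limr_ge ?limr_le //; apply: nearW => m; case/andP: (bd m c).
Qed.

(** The digit is the integer part of [k * t], except at [t = 1], where that would be [k]; there the
    digit [k - 1] leaves the remainder [1]. *)
Lemma digit_exists (t : R) : 0 <= t <= 1 ->
  exists b : 'I_k, 0 <= k%:R * t - b%:R <= 1.
Proof.
case/andP => t0 t1; have kt0 : 0 <= k%:R * t by rewrite mulr_ge0.
have [t_lt1|t_ge1] := ltP t 1.
  have /andP[h1 h2] := truncn_itv kt0.
  have bk : (Num.truncn (k%:R * t) < k)%N.
    by rewrite -(ltr_nat R) (le_lt_trans h1) // gtr_pMr.
  exists (Ordinal bk); rewrite /= subr_ge0 h1 lerBlDr addrC natr1; exact: ltW.
have -> : t = 1 by apply/eqP; rewrite eq_le t1.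
have bk : (k.-1 < k)%N by rewrite prednK.
exists (Ordinal bk) => /=.
by rewrite mulr1 -[in k%:R](prednK k_gt0) -natr1 addrAC subrr add0r ler01 lexx.
Qed.

Lemma representation_exists (t : R) : 0 <= t <= 1 ->
  exists c : nat -> 'I_k, is_representation c t.
Proof.
move=> t01.
have [D HD] : exists D : R -> 'I_k, forall t, 0 <= t <= 1 -> 0 <= k%:R * t - (D t)%:R <= 1.
  have H (y : R) : exists b : 'I_k, 0 <= y <= 1 -> 0 <= k%:R * y - b%:R <= 1.
    have [y01|_] := boolP (0 <= y <= 1); last by exists (Ordinal k_gt0).
    by have [b Hb] := digit_exists y01; exists b.
  by exists (fun y => sval (cid (H y))) => y; exact: svalP (cid (H y)).
(* [T n] is the remainder after [n] digits; it stays in the unit interval, so the partial sum misses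
   [t] by at most [k ^- n]. *)
pose T n := iter n (fun y => k%:R * y - (D y)%:R) t.
have T01 n : 0 <= T n <= 1 by elim: n => // n IH; apply: HD.
pose c n := D (T n); exists c.
have E n : digit_series c n = t - T n * (k%:R ^+ n)^-1.
  elim: n => [|n IH].
    by rewrite /digit_series seriesEnat /= big_geq // expr0 invr1 mulr1 subrr.
  rewrite /digit_series seriesSr -/(digit_series c n) IH /= /c exprS.
  by field; rewrite k0 expf_neq0.
have -> : t = t - 0 by rewrite subr0.
rewrite /is_representation -/(digit_series c) (funext E).
apply: cvgB; first exact: cvg_cst.
have : geometric 1 (k%:R^-1 : R) @ \oo --> 0.
  by apply: cvg_geometric; rewrite ger0_norm ?invr_ge0 ?ltW // invf_lt1 // ltr1n.
apply: squeeze_cvgr; last exact: cvg_cst.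
apply: nearW => n; have /andP[h0 h1] := T01 n.
have ki : 0 <= (k%:R ^+ n)^-1 :> R by rewrite invr_ge0 exprn_ge0 // ltW.
by rewrite mulr_ge0 //= mul1r exprVn ler_piMl.
Qed.
End Representations.

(** * Zooming in along words *)

Definition digit_piece (R : realType) (d k : nat) (b : letter d k)
    (Z : set 'rV[R]_d) : set 'rV[R]_d :=
  rescaled_piece k 1 (fun l => b l) Z.

(** With [foldl] the first letter selects the coarsest cube: [rcons] zooms once more into the piece,
    while a leading letter changes the initial set. *)
Definition word_piece (R : realType) (d k : nat) (u : seq (letter d k))
    (Z : set 'rV[R]_d) : set 'rV[R]_d :=
  foldl (fun Y b => digit_piece b Y) Z u.

Definition word_count (R : realType) (d k p : nat) (Z : set 'rV[R]_d) : nat :=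
  #|[pred u : p.-tuple (letter d k) | `[< word_piece u Z !=set0 >]]|.

Section Pieces.
Variables (R : realType) (d k : nat).
Hypothesis k_gt1 : (1 < k)%N.
Implicit Types (Z : set 'rV[R]_d) (b : letter d k) (u : seq (letter d k)).
Implicit Types (c : 'I_d -> nat -> 'I_k) (x y : 'rV[R]_d).

Let kp : 0 < k%:R :> R. Proof. by rewrite ltr0n ltnW. Qed.

(** Lying in the grid cube of [b] amounts to the rescaled point lying in the unit cube, which
    removes all quotients. *)
Lemma digit_pieceP b Z y :
  digit_piece b Z y <->
  exists x, [/\ Z x, unit_cube y & forall l, y 0 l = k%:R * x 0 l - (b l)%:R].
Proof.
split=> [[x [Zx xg] <-]|[x [Zx y01 yE]]].
  exists x; split => // l; last by rewrite mxE expr1.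
  have := xg l; rewrite !mxE expr1 ler_pdivrMr // ler_pdivlMr // => /andP[h1 h2].
  by apply/andP; split; lra.
exists x; last by apply/rowP => l; rewrite mxE expr1 yE.
split => // l; have := y01 l; rewrite yE expr1 ler_pdivrMr // ler_pdivlMr //.
by case/andP => h1 h2; apply/andP; split; lra.
Qed.

(** The point reached is the one represented by the remaining digits; having a representation keeps
    it in the unit cube. *)
Lemma word_piece_digits Z c x p :
  Z x -> (forall l, is_representation (c l) (x 0 l)) ->
  exists2 y, word_piece (mkseq (fun j => [ffun l => c l j]) p) Z y &
    forall l, is_representation (fun j => c l (p + j)%N) (y 0 l).
Proof.
move=> Zx cx; elim: p => [|p [y Zy cy]]; first by exists x.
pose z : 'rV[R]_d := \row_l (k%:R * y 0 l - (c l p)%:R).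
have cz l : is_representation (fun j => c l (p.+1 + j)%N) (z 0 l).
  have /(representation_shift k_gt1) := cy l; rewrite addn0 mxE.
  by under eq_fun do rewrite addnS -addSn.
exists z => //; rewrite mkseqS /word_piece foldl_rcons.
apply/digit_pieceP; exists y; split => // l; last by rewrite mxE ffunE.
exact: (representation_itv k_gt1 (cz l)).
Qed.

(** Converse reading: the letters of [u] are prepended, last one first, to the given representations
    of [y]. *)
Lemma word_piece_preimage Z c u y :
  word_piece u Z y -> (forall l, is_representation (c l) (y 0 l)) ->
  exists x c', [/\ Z x, forall l, is_representation (c' l) (x 0 l)
    & u = mkseq (fun j => [ffun l => c' l j]) (size u)].
Proof.
elim: u Z => [|b u IH] Z /=; first by move=> Zy cy; exists y, c.
move=> /IH{}IH /IH[x1 [c1 [/digit_pieceP[x [Zx x101 x1E]] cx1 uE]]].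
pose c' l j := if j is j'.+1 then c1 l j' else b l.
exists x, c'; split => // [l|].
  by apply/(representation_shift k_gt1); rewrite /= -x1E.
apply: (@eq_from_nth _ b); first by rewrite size_mkseq.
move=> [|i] ui; rewrite nth_mkseq //=; first by apply/ffunP => l; rewrite ffunE.
by rewrite {1}uE nth_mkseq.
Qed.

Lemma word_piece_sub_unit_cube u Z : Z `<=` @unit_cube R d ->
  word_piece u Z `<=` @unit_cube R d.
Proof.
move=> Z01; elim/last_ind: u => [//|u b _] y.
by rewrite /word_piece foldl_rcons => /digit_pieceP[x []].
Qed.

Lemma unit_cube_representation x : unit_cube x ->
  exists c, forall l, is_representation (c l) (x 0 l).
Proof.
move=> x01; have H l := representation_exists k_gt1 (x01 l).
by exists (fun l => sval (cid (H l))) => l; exact: svalP (cid (H l)).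
Qed.

(** Subdividing cube [b] of level [a] yields the cubes [k * b + r] of level [a.+1]; they stay inside
    it because [0 <= r] and [r + 1 <= k]. *)
Lemma digit_piece_rescaled a (b : 'I_d -> nat) (r : letter d k) Z :
  digit_piece r (rescaled_piece k a b Z) =
  rescaled_piece k a.+1 (fun l => k * b l + r l)%N Z.
Proof.
have Kp : 0 < k%:R ^+ a :> R by rewrite exprn_gt0.
have KSp : 0 < k%:R ^+ a.+1 :> R by rewrite exprn_gt0.
apply/seteqP; split=> y.
  move=> /digit_pieceP[_ [[x [Zx xg] <-] y01 yE]].
  exists x; last by apply/rowP => l; rewrite yE !mxE natrD natrM exprS; ring.
  split => // l; have := y01 l; rewrite yE mxE ler_pdivrMr // ler_pdivlMr //.
  rewrite natrD natrM exprS => /andP[h1 h2]; apply/andP; split; lra.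
move=> [x [Zx xg] <-].
apply/digit_pieceP; exists (\row_l (k%:R ^+ a * x 0 l - (b l)%:R)).
have rk l : (r l)%:R + 1 <= k%:R :> R by rewrite natr1 ler_nat.
split.
- exists x => //; split => // l; have := xg l.
  rewrite !ler_pdivrMr // !ler_pdivlMr // natrD natrM exprS => /andP[h1 h2].
  have r0 : 0 <= (r l)%:R :> R by [].
  have rkl := rk l.
  by apply/andP; split; rewrite -(ler_pM2l kp); lra.
- move=> l; have := xg l; rewrite mxE.
  rewrite !ler_pdivrMr // !ler_pdivlMr // natrD natrM exprS => /andP[h1 h2].
  by apply/andP; split; lra.
- by move=> l; rewrite !mxE natrD natrM exprS; ring.
Qed.

(** The letters of [u] are the base-[k] digits of the corner [b], most significant first; the
    induction splits off the last one as a remainder modulo [k]. At level [0] the piece is [X]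
    itself, as [X] lies in the unit cube. *)
Lemma kernel_setsP (X Z : set 'rV[R]_d) : X `<=` @unit_cube R d ->
  kernel_sets k X Z <-> exists u : seq (letter d k), Z = word_piece u X.
Proof.
move=> X01; split.
  move=> [a [b [bk ->]]] {Z}; elim: a b bk => [|a IH] b bk.
    exists [::]; rewrite /word_piece /=.
    have b0 l : b l = 0%N by move: (bk l); rewrite expn0; case: (b l).
    apply/seteqP; split => [_ [x [Xx _] <-]|x Xx].
      suff -> : \row_l (k%:R ^+ 0 * x ord0 l - (b l)%:R) = x by [].
      by apply/rowP => l; rewrite mxE b0 expr0 mul1r subr0.
    exists x; last by apply/rowP => l; rewrite mxE b0 expr0 mul1r subr0.
    by split => // l; rewrite b0 expr0 !divr1 add0r; exact: X01.
  have k_gt0 : (0 < k)%N by exact: ltnW.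
  have [l|u Hu] := IH (fun l => b l %/ k)%N; first by rewrite ltn_divLR // -expnSr.
  pose r : letter d k := [ffun l => Ordinal (ltn_pmod (b l) k_gt0)].
  exists (rcons u r); rewrite /word_piece foldl_rcons -/(word_piece u X) -Hu.
  rewrite digit_piece_rescaled; congr rescaled_piece; apply/funext => l.
  by rewrite ffunE /= mulnC -divn_eq.
move=> [u ->] {Z}; elim/last_ind: u => [|u r [a [b [bk E]]]].
  exists 0%N, (fun=> 0%N); split => //; rewrite /word_piece /=.
  apply/seteqP; split => [x Xx|_ [x [Xx _] <-]].
    exists x; last by apply/rowP => l; rewrite mxE expr0 mul1r subr0.
    by split => // l; rewrite expr0 !divr1 add0r; exact: X01.
  suff -> : \row_l (k%:R ^+ 0 * x ord0 l - 0%:R) = x by [].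
  by apply/rowP => l; rewrite mxE expr0 mul1r subr0.
exists a.+1, (fun l => k * b l + r l)%N; split => [l|].
  rewrite expnS (@leq_trans (k * (b l).+1)) ?leq_mul2l ?bk ?orbT //.
  by rewrite mulnS addnC ltn_add2r ltn_ord.
by rewrite /word_piece foldl_rcons -/(word_piece u X) E digit_piece_rescaled.
Qed.

(** The [m] skipped letters lead from [X] to the kernel set [Z], from which [u] is then read.
    Conversely, any representation of a point of the final piece completes the concatenated word to
    an infinite one. *)
Lemma languageP (X : set 'rV[R]_d) u : X `<=` @unit_cube R d ->
  language X u <->
  exists Z, [/\ kernel_sets k X Z, Z !=set0 & word_piece u Z !=set0].
Proof.
move=> X01; split.
  move=> [x [c [m [p [Xx cx ->]]]]].
  have [y Xy cy] := word_piece_digits m Xx cx.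
  have [z Xz _] := word_piece_digits p Xy cy.
  exists (word_piece (mkseq (fun j => [ffun l => c l j]) m) X).
  by split; [apply/kernel_setsP => //; eexists | exists y | exists z].
move=> [_ [/kernel_setsP -/(_ X01)[w ->] _ [y]]].
rewrite /word_piece -foldl_cat => Xy.
have /unit_cube_representation[c cy] := word_piece_sub_unit_cube X01 Xy.
have [x [c' [Xx cx wuE]]] := word_piece_preimage Xy cy.
exists x, c', (size w), (size u); split => //.
pose b0 : letter d k := [ffun=> Ordinal (ltnW k_gt1)].
apply: (@eq_from_nth _ b0); rewrite ?size_mkseq // => i ui.
rewrite nth_mkseq //; have := congr1 (fun v => nth b0 v (size w + i)) wuE.
rewrite /= nth_cat ltnNge leq_addr /= addKn => ->.
by rewrite nth_mkseq // size_cat ltn_add2l.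
Qed.

End Pieces.

(** * Counting words with the matrix of copies *)

Lemma card_pred_sum (T : finType) (P : pred T) : #|[pred x | P x]| = (\sum_x P x)%N.
Proof.
by rewrite -sum1_card big_mkcond; apply: eq_bigr => x _; rewrite inE; case: (P x).
Qed.

Section Counting.
Variables (R : realType) (d k : nat).
Hypothesis k_gt1 : (1 < k)%N.
Implicit Types (Z : set 'rV[R]_d).

Lemma word_piece_set0 (u : seq (letter d k)) : word_piece u (@set0 'rV[R]_d) = set0.
Proof.
elim: u => //= b u; rewrite /word_piece /=.
suff -> : digit_piece b (@set0 'rV[R]_d) = set0 by [].
by apply/seteqP; split => // y [x [[]]].
Qed.

Lemma word_count_set0 p : word_count k p (@set0 'rV[R]_d) = 0%N.
Proof.
apply: eq_card0 => u; rewrite !inE word_piece_set0.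
by apply/asboolP => -[].
Qed.

Lemma word_count0 Z : Z !=set0 -> word_count k 0 Z = 1%N.
Proof.
move=> Z0; rewrite /word_count (@fintype.eq_card1 _ [tuple]) // => u.
by rewrite !inE tuple0 eqxx; apply/asboolP.
Qed.

Lemma word_countS p Z :
  word_count k p.+1 Z = (\sum_(b : letter d k) word_count k p (digit_piece b Z))%N.
Proof.
rewrite /word_count card_pred_sum; under [RHS]eq_bigr => b _ do rewrite card_pred_sum.
rewrite pair_big /= (reindex (fun bu : letter d k * p.-tuple (letter d k) =>
  [tuple of bu.1 :: bu.2])) /=; first by apply: eq_bigr => -[b u] _.
exists (fun u : p.+1.-tuple (letter d k) => (thead u, [tuple of behead u])).
  by move=> [b u] _ /=; rewrite theadE; congr pair; apply: val_inj.
by move=> u _ /=; rewrite -tuple_eta.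
Qed.

Lemma word_count_gt0 p Z : Z `<=` @unit_cube R d -> Z !=set0 ->
  (0 < word_count k p Z)%N.
Proof.
move=> Z01 [x Zx]; have [c cx] := unit_cube_representation k_gt1 (Z01 _ Zx).
have [y Zy _] := word_piece_digits k_gt1 p Zx cx.
apply/card_gt0P; exists [tuple of mkseq (fun j => [ffun l => c l j]) p].
by apply/asboolP; exists y.
Qed.

Section Kernel.
Variables (X : set 'rV[R]_d) (n : nat) (Xs : 'I_n -> set 'rV[R]_d).
Hypothesis X01 : X `<=` @unit_cube R d.
Hypothesis Xs_inj : injective Xs.
Hypothesis XsE : range Xs = [set Z | kernel_sets k X Z /\ Z !=set0].

Lemma kernel_family i : kernel_sets k X (Xs i) /\ Xs i !=set0.
Proof. by have : range Xs (Xs i) by []; rewrite XsE. Qed.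

Lemma kernel_family_sub_unit_cube i : Xs i `<=` @unit_cube R d.
Proof.
have [/kernel_setsP -/(_ k_gt1 X01)[u ->] _] := kernel_family i.
exact: word_piece_sub_unit_cube.
Qed.

(** Words are sorted by their first letter [b]. A nonempty piece [digit_piece b (Xs j)] equals
    exactly one [Xs i]; an empty one contributes nothing to either side. *)
Lemma word_count_copies p j :
  (word_count k p.+1 (Xs j))%:R =
  \sum_i (word_count k p (Xs i))%:R * copies_matrix k Xs i j.
Proof.
rewrite word_countS natr_sum.
under [RHS]eq_bigr => i _.
  rewrite mxE card_pred_sum natr_sum mulr_sumr.
  over.
rewrite exchange_big /=; apply: eq_bigr => b _.
rewrite -[rescaled_piece _ _ _ _]/(digit_piece b (Xs j)).
have [pb0|] := pselect (digit_piece b (Xs j) !=set0); last first.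
  move/set0P/negP; rewrite negbK => /eqP pb0.
  rewrite pb0 word_count_set0 big1 // => i _.
  have [_ [x Xix]] := kernel_family i.
  by rewrite asboolF ?mulr0 // => E; rewrite -E in Xix.
(* The kernel is closed under zooming: [b] is appended to the word that produces [Xs j]. *)
have [i1 _ Ei1] : range Xs (digit_piece b (Xs j)).
  rewrite XsE; split => //.
  have [/(kernel_setsP k_gt1 _ X01)[u Eu] _] := kernel_family j.
  apply/(kernel_setsP k_gt1 _ X01); exists (rcons u b).
  by rewrite /word_piece foldl_rcons -/(word_piece u X) -Eu.
rewrite (bigD1 i1) //= big1 => [|i i_i1].
  by rewrite asboolT ?mulr1 ?addr0 Ei1.
by rewrite asboolF ?mulr0 // -Ei1 => /Xs_inj E; rewrite E eqxx in i_i1.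
Qed.

Lemma language_kernel (u : seq (letter d k)) :
  language X u <-> exists i, word_piece u (Xs i) !=set0.
Proof.
rewrite languageP //; split => [[Z [ZX Z0 uZ]]|[i ui]].
  have [i _ Ei] : range Xs Z by rewrite XsE.
  by exists i; rewrite Ei.
by have [iX i0] := kernel_family i; exists (Xs i).
Qed.

Lemma word_count_le_complexity p i : (word_count k p (Xs i) <= complexity k X p)%N.
Proof.
apply: subset_leq_card; apply/fintype.subsetP => u /asboolP ui.
by apply/asboolP/language_kernel; exists i.
Qed.

Lemma complexity_le_word_count p :
  (complexity k X p <= \sum_i word_count k p (Xs i))%N.
Proof.
rewrite /complexity card_pred_sum.
under [leqRHS]eq_bigr => i _ do rewrite /word_count card_pred_sum.
rewrite exchange_big /=; apply: leq_sum => u _.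
case: asboolP => // /language_kernel[i ui].
by rewrite (bigD1 i) //= asboolT.
Qed.

End Kernel.
End Counting.

(** * Matrix powers, complexity and entropy *)

(** The row vector of counts is multiplied on the right by the matrix at each step, starting from
    the all-ones vector. *)
Lemma word_count_expmx (R : realType) (d k : nat) (X : set 'rV[R]_d) (n : nat)
    (Xs : 'I_n.+1 -> set 'rV[R]_d) (p : nat) (j : 'I_n.+1) :
  (1 < k)%N -> X `<=` @unit_cube R d -> injective Xs ->
  range Xs = [set Z | kernel_sets k X Z /\ Z !=set0] ->
  (word_count k p (Xs j))%:R = \sum_i (copies_matrix k Xs ^+ p) i j.
Proof.
move=> k1 X01 Xs_inj XsE; elim: p j => [|p IH] j.
  rewrite word_count0; last by have [] := kernel_family XsE j.
  by rewrite (bigD1 j) //= big1 ?mxE ?eqxx ?addr0 // => i /negPf ij; rewrite mxE ij.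
rewrite (word_count_copies k1 X01 Xs_inj XsE).
under eq_bigr => i _ do rewrite IH mulr_suml.
rewrite exchange_big /=; apply: eq_bigr => i _.
by rewrite exprSr mxE.
Qed.

Theorem proposition2 (R : realType) (d k : nat) (X : set 'rV[R]_d)
    (n : nat) (Xs : 'I_n -> set 'rV[R]_d) :
  (1 <= d)%N -> (2 <= k)%N ->
  X !=set0 -> self_similar k X ->
  injective Xs -> range Xs = [set Z | kernel_sets k X Z /\ Z !=set0] ->
  [/\ entropy_seq k X @ \oo --> entropy k X,
      0 < spectral_radius (copies_matrix k Xs)
    & entropy k X = log k (spectral_radius (copies_matrix k Xs))].
Proof.
move=> _ k1 X0 [_ X01 _] Xs_inj XsE.
(* [X] is its own piece along the empty word, so the index type is inhabited and the case of size
   [0] is excluded. *)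
have [i0 _ _] : range Xs X.
  by rewrite XsE; split => //; apply/(kernel_setsP k1 _ X01); exists [::].
case: n Xs i0 Xs_inj XsE => [|n] Xs i0 Xs_inj XsE; first by case: i0.
set A := copies_matrix k Xs.
have A0 i j : 0 <= A i j by rewrite mxE.
pose S p := \sum_j \sum_i (A ^+ p) i j.
have SE p : S p = (\sum_j word_count k p (Xs j))%:R.
  by rewrite natr_sum; apply: eq_bigr => j _; rewrite (word_count_expmx _ _ k1 X01).
have count_gt0 p i : (0 < word_count k p (Xs i))%N.
  apply: word_count_gt0 => //; first exact: kernel_family_sub_unit_cube XsE i.
  by have [] := kernel_family XsE i.
have S1 p : 1 <= S p.
  by rewrite SE ler1n (bigD1 i0) //= addn_gt0 count_gt0.
have rho0 := spectral_radius_gt0 A0 S1.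
have P_gt0 p : 0 < (complexity k X p)%:R :> R.
  by rewrite ltr0n (leq_trans (count_gt0 p i0)) // word_count_le_complexity.
have P_le p : (complexity k X p)%:R <= S p by rewrite SE ler_nat complexity_le_word_count.
(* Each of the [n.+1] column sums counts words of the language, possibly the same ones. *)
have P_ge p : S p <= n.+1%:R * (complexity k X p)%:R.
  rewrite SE -natrM ler_nat -[X in (_ <= X * _)%N]card_ord -sum_nat_const.
  by apply: leq_sum => i _; apply: word_count_le_complexity.
have cvg_ln : (fun p => p%:R^-1 * ln (complexity k X p)%:R) @ \oo
    --> ln (spectral_radius A).
  apply: cvg_ln_root => // r.
    move=> /(sum_expmx_le A0)[K HK]; exists K => p.
    exact: le_trans (P_le p) (HK p).
  move=> r0 /(sum_expmx_ge A0 r0)[K K0 HK]; exists (K * n.+1%:R) => [|p].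
    by rewrite mulr_gt0.
  by rewrite (le_trans (HK p)) // -mulrA ler_pM2l //; exact: P_ge.
have cvg_entropy : entropy_seq k X @ \oo --> log k (spectral_radius A).
  have -> : entropy_seq k X = (fun p => p%:R^-1 * ln (complexity k X p)%:R / ln k%:R : R).
    by apply/funext => p; rewrite /entropy_seq /log mulrA.
  by apply: cvgM => //; exact: cvg_cst.
have entropyE : entropy k X = log k (spectral_radius A) by exact: cvg_lim cvg_entropy.
by split => //; rewrite entropyE.
Qed.
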